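(* Consider the networked system $\dot X=\Phi X$, $Y=\Psi X$ with $\Phi=I_N\otimes A+L\otimes H$ and $\Psi=\Delta\otimes C$, and let $\bar\Phi=I_N\otimes A+\bar L\otimes H$. If the topological change $L\to\bar L$ is $\Psi$-discernible for this networked system, then the topological change $L\to\bar L$ is $\Delta$-discernible for the system $\dot x=Lx$, $y=\Delta x$.
   Context: Setting. $N\ge 2$; $A\in\mathbb R^{n\times n}$, $H\in\mathbb R^{n\times n}$, $C\in\mathbb R^{p\times n}$. $L=[w_{ij}]\in\mathbb R^{N\times N}$ is the weight matrix of a directed weighted graph on $N$ nodes, with $w_{ii}=0$ and $w_{ij}\ne 0$ exactly when there is an edge from node $j$ to node $i$ (weights are otherwise arbitrary real numbers). $\Delta=\mathrm{diag}\{\delta_1,\dots,\delta_N\}$ with $\delta_i=1$ if node $i$ is measured and $\delta_i=0$ otherwise. The networked system consists of $N$ nodes $\dot x_i=Ax_i+\sum_{j=1}^N w_{ij}Hx_j$, $y_i=Cx_i$, with stacked state $X=[x_1^T,\dots,x_N^T]^T\in\mathbb R^{Nn}$. A topological change replaces $L$ by another real $N\times N$ weight matrix $\bar L$ with zero diagonal (edges removed or added, or edge weights changed), giving the new system $\dot{\bar X}=\bar\Phi\bar X$, $\bar Y=\Psi\bar X$. $\otimes$ is the Kronecker product. Discernibility. A pair of initial states $(X_0,\bar X_0)\in\mathbb R^{Nn}\times\mathbb R^{Nn}$ is called $\Psi$-indiscernible with respect to $L\to\bar L$ if $\Psi e^{\Phi t}X_0=\Psi e^{\bar\Phi t}\bar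 X_0$ for all $t\ge 0$. The change $L\to\bar L$ is called $\Psi$-discernible (for the networked system) if the only $\Psi$-indiscernible pair is the trivial one $(\mathbf 0_{Nn},\mathbf 0_{Nn})$. Likewise, $L\to\bar L$ is called $\Delta$-discernible for the system $\dot x=Lx$, $y=\Delta x$ if the only pair $(x_0,\bar x_0)\in\mathbb R^N\times\mathbb R^N$ with $\Delta e^{Lt}x_0=\Delta e^{\bar Lt}\bar x_0$ for all $t\ge 0$ is $(\mathbf 0_N,\mathbf 0_N)$. *)

(* Defs.v *)
From HB Require Import structures.
From mathcomp Require Import all_boot all_order all_algebra.
From mathcomp Require Import all_classical all_reals all_analysis.
From mathcomp Require Export mxtens.

Set Implicit Arguments.
Unset Strict Implicit.
Unset Printing Implicit Defensive.

Import Order.TTheory GRing.Theory Num.Theory.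
Import numFieldNormedType.Exports.

Local Open Scope classical_set_scope.
Local Open Scope ring_scope.

(* The Kronecker product is [A *t B] from mxtens: the row index [i * n + k] of
   ['cV_(N * n)] is coordinate [k] of node [i], so that a vector of this type
   is the stacked state [x_1; ...; x_N]. *)

(* The limit is taken in the (complete) matrix topology. *)
Definition expmx (R : realType) (m : nat) (M : 'M[R]_m) : 'M[R]_m :=
  limn (series (fun k : nat => (k`!%:R)^-1 *: M ^+ k)).

Definition hollow (R : realType) (N : nat) (L : 'M[R]_N) : Prop :=
  forall i : 'I_N, L i i = 0.

Definition measmx (R : realType) (N : nat) (S : {set 'I_N}) : 'M[R]_N :=
  diag_mx (\row_i (i \in S)%:R).

Definition netmx (R : realType) (N n : nat) (A H : 'M[R]_n) (L : 'M[R]_N) :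
    'M[R]_(N * n) :=
  (1%:M : 'M[R]_N) *t A + L *t H.

Definition netout (R : realType) (N n p : nat) (S : {set 'I_N})
    (C : 'M[R]_(p, n)) : 'M[R]_(N * p, N * n) :=
  measmx R S *t C.

Definition indiscernible (R : realType) (m q : nat) (Out : 'M[R]_(q, m))
    (F Fbar : 'M[R]_m) (X0 Xbar0 : 'cV[R]_m) : Prop :=
  forall t : R, 0 <= t ->
    Out *m expmx (t *: F) *m X0 = Out *m expmx (t *: Fbar) *m Xbar0.

(* The change of system matrix from [F] to [Fbar], observed through [Out]. *)
Definition discernible (R : realType) (m q : nat) (Out : 'M[R]_(q, m))
    (F Fbar : 'M[R]_m) : Prop :=
  forall X0 Xbar0 : 'cV[R]_m,
    indiscernible Out F Fbar X0 Xbar0 -> X0 = 0 /\ Xbar0 = 0.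

(* Main.v *)
From HB Require Import structures.
Require Import Defs.
From mathcomp Require Import all_boot all_order all_algebra.
From mathcomp Require Import all_classical all_reals all_analysis.
From mathcomp Require Import lra.

(** A counterexample for the node dynamics [L] lifts to one for the network: if
    [(x, y)] is a nontrivial indiscernible pair for [L] and [Lbar], then so is
    [(x *t v, y *t v)] for the network, whatever the nonzero vector [v].

    An indiscernible pair is detected by Markov parameters. Since
    [t |-> Out *m expmx (t *: F) *m X] is an everywhere convergent power series
    in [t] with coefficients [Out *m F ^+ k *m X / k!], two outputs agree for
    all [t >= 0] exactly when all these coefficients agree
    ([indiscernibleP]); the converse rests on the convergence of the matrix
    exponential ([cvg_expmx_entry]), the direct implication on the identity
    principle for power series ([pseries_eq0]).

    It remains to compare Markov parameters, which is algebra. The network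
    matrix sends [x *t v] to [x *t (A *m v) + (L *m x) *t (H *m v)], and if
    [Out *m L ^+ j *m x] and [Out *m Lbar ^+ j *m y] agree for all [j], they
    still do when [x] and [y] are replaced by [L *m x] and [Lbar *m y]. An
    induction on the exponent, over all such pairs [(x, y)] and all [v], thus
    transfers the equalities to the network ([netmx_markov]). As nodes have at
    least one coordinate, the all-ones vector is a valid choice of [v]. *)

Set Implicit Arguments.
Unset Strict Implicit.
Unset Printing Implicit Defensive.

Import Order.TTheory GRing.Theory Num.Theory.
Import numFieldNormedType.Exports.

Local Open Scope classical_set_scope.
Local Open Scope ring_scope.

Lemma psum_recl (R : comNzRingType) (b : nat -> R) (t : R) (n : nat) :
  \sum_(j < n.+1) b j * t ^+ j = b 0%N + t * \sum_(j < n) b j.+1 * t ^+ j.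
Proof.
rewrite big_ord_recl expr0 mulr1 mulr_sumr; congr (_ + _).
by apply: eq_bigr => i _; rewrite !lift0 exprS mulrCA.
Qed.

(** Comparison with a geometric series of ratio at most one half; the bound is
    uniform in [n], so that it survives the passage to the limit. *)
Lemma norm_psum_le_half (R : realFieldType) (b : nat -> R) (c t : R) (n : nat) :
  0 <= t -> t <= 2^-1 -> (forall k, `|b k| <= c) ->
  `|\sum_(j < n) b j * t ^+ j| <= 2 * c.
Proof.
move=> t0 t1; elim: n b => [|n IH] b bc.
  by rewrite big_ord0 normr0 mulr_ge0// (le_trans _ (bc 0%N)).
rewrite psum_recl.
have := IH (fun k => b k.+1) (fun k => bc k.+1); set s := \sum_(_ < _) _ => hs.
rewrite (le_trans (ler_normD _ _))// normrM (ger0_norm t0).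
have h : t * `|s| <= 2^-1 * (2 * c) by apply: ler_pM.
by have := bc 0%N; lra.
Qed.

(** The partial sums differ from [b 0] by at most a constant times [t], and [t]
    may tend to 0. The point 0 itself is excluded from the assumption so that
    it passes to the shifted series, obtained by dividing by [t]. *)
Lemma pseries_eq0_head (R : realType) (b : R^nat) :
  (forall t, 0 < t <= 1 -> series (fun k => b k * t ^+ k) @ \oo --> 0) ->
  b 0%N = 0.
Proof.
move=> b0.
(* Convergence at [t = 1] bounds the coefficients. *)
have [c [c0 bc]] : exists c, 0 < c /\ forall k, `|b k| <= c.
  have /b0 h : 0 < (1 : R) <= 1 by rewrite ltr01 lexx.
  have /cvg_series_bounded : cvgn (series b).
    have -> : b = (fun k => b k * 1 ^+ k).
      by apply/funext => k; rewrite expr1n mulr1.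
    by apply/cvg_ex; exists 0.
  by move=> /pinfty_ex_gt0[c c0 cb]; exists c; split => // k; exact: cb.
have small t : 0 < t <= 2^-1 -> `|b 0%N| <= t * (2 * c).
  move=> /andP[t0 t1].
  have /b0 h : 0 < t <= 1 by rewrite t0 (le_trans t1)//; lra.
  rewrite -subr_ge0.
  have hc : (fun n => t * (2 * c) - `|b 0%N - series (fun k => b k * t ^+ k) n|)
      @ \oo --> t * (2 * c) - `|b 0%N - 0|.
    by apply: cvgB; [exact: cvg_cst|apply: cvg_norm; apply: cvgB => //;
      exact: cvg_cst].
  rewrite -[b 0%N]subr0 -(cvg_lim _ hc)//.
  apply: limr_ge; first by apply/cvg_ex; eexists; exact: hc.
  exists 1%N => // -[//|n] _ /=.
  rewrite subr_ge0 /series /= big_mkord psum_recl opprD addrA subrr add0r normrN.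
  rewrite normrM (gtr0_norm t0) ler_wpM2l ?(ltW t0)//.
  by apply: (norm_psum_le_half (b := fun k => b k.+1)) => //; exact: ltW.
apply/eqP; rewrite -normr_le0; apply/ler_addgt0Pl => e e0; rewrite addr0.
pose t := Num.min (2^-1) (e / (2 * c)).
have c20 : 0 < 2 * c by rewrite mulr_gt0.
have t0 : 0 < t by rewrite lt_min divr_gt0// invr_gt0 ltr0n.
rewrite (le_trans (small t _))//; first by rewrite t0 ge_min lexx.
by rewrite -ler_pdivlMr// ge_min lexx orbT.
Qed.

(** Identity principle for power series on a one-sided neighbourhood of 0: once
    the head vanishes, dividing by [t] puts the next coefficient at the head. *)
Lemma pseries_eq0 (R : realType) (b : R^nat) :
  (forall t, 0 < t <= 1 -> series (fun k => b k * t ^+ k) @ \oo --> 0) ->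
  forall k, b k = 0.
Proof.
move=> + k; elim: k b => [|k IH] b b0; first exact: pseries_eq0_head.
apply: (IH (fun k => b k.+1)) => t t01.
have /andP[t0 _] := t01.
have hb := pseries_eq0_head b0.
have -> : series (fun k => b k.+1 * t ^+ k) =
    (fun n => t^-1 * series (fun k => b k * t ^+ k) n.+1).
  apply/funext => n; rewrite /series /= !big_mkord psum_recl hb add0r.
  by rewrite mulKf ?gt_eqF.
rewrite -[0](mulr0 t^-1); apply: cvgM; first exact: cvg_cst.
by have := b0 _ t01; rewrite -(cvg_shiftS (series _)).
Qed.

(** The norm on matrices is the largest modulus of an entry, which is only
    submultiplicative up to the inner dimension. *)
Lemma norm_mulmx_le (R : realType) m n p (A : 'M[R]_(m, n)) (B : 'M[R]_(n, p)) :
  `|A *m B| <= n%:R * `|A| * `|B|.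
Proof.
rewrite [leLHS]/Num.Def.normr/= mx_normrE bigmax_le// => -[i j] _ /=.
have entry q r (M : 'M[R]_(q, r)) k l : `|M k l| <= `|M|.
  rewrite [leRHS]/Num.Def.normr/= mx_normrE.
  by apply/bigmax_geP; right; exists (k, l).
rewrite mxE (le_trans (ler_norm_sum _ _ _))//.
have -> : n%:R * `|A| * `|B| = \sum_(k < n) `|A| * `|B|.
  by rewrite sumr_const card_ord -mulrA mulr_natl.
by apply: ler_sum => k _; rewrite normrM ler_pM.
Qed.

Lemma norm_exprmx_le (R : realType) m (M : 'M[R]_m) k :
  `|M ^+ k| <= `|1%:M : 'M[R]_m| * (m%:R * `|M|) ^+ k.
Proof.
elim: k => [|k IH]; first by rewrite !expr0 mulr1.
rewrite !exprS (le_trans (norm_mulmx_le _ _))//.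
by rewrite mulrCA ler_wpM2l// mulr_ge0.
Qed.

(** Matrices are complete and normed; the join of both structures is what makes
    absolute convergence of a matrix series imply its convergence. *)
HB.instance Definition _ (R : realType) (m n : nat) :=
  Uniform_isComplete.Build 'M[R]_(m, n) (@cauchy_cvg _).

(** The terms are dominated by those of the real exponential series at
    [m%:R * `|M|]. *)
Lemma is_cvg_expmx (R : realType) m (M : 'M[R]_m) :
  cvgn (series (fun k : nat => (k`!%:R)^-1 *: M ^+ k)).
Proof.
apply: normed_cvg.
apply: (@series_le_cvg _ _
  (fun k => `|1%:M : 'M[R]_m| * exp_coeff (m%:R * `|M|) k)) => [k|k|k|].
- exact: normr_ge0.
- by rewrite mulr_ge0// exp_coeff_ge0// mulr_ge0.
- rewrite /= normrZ ger0_norm ?invr_ge0// /exp_coeff /= mulrA mulrC.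
  by rewrite ler_wpM2r ?invr_ge0// norm_exprmx_le.
- by apply: is_cvg_seriesZ; exact: is_cvg_series_exp_coeff.
Qed.

Lemma exprmxZ (R : realType) m (t : R) (M : 'M[R]_m) k :
  (t *: M) ^+ k = t ^+ k *: M ^+ k.
Proof.
elim: k => [|k IH]; first by rewrite !expr0 scale1r.
by rewrite !exprS IH -[LHS]scalemxAl -scalemxAr scalerA.
Qed.

(** The map [M |-> (Out *m M *m X) i j] is linear and continuous, hence commutes
    with the sum of the exponential series. *)
Lemma cvg_expmx_entry (R : realType) m q r (Out : 'M[R]_(q, m)) (F : 'M[R]_m)
    (X : 'M[R]_(m, r)) (t : R) i j :
  series (fun k => (k`!%:R)^-1 * (Out *m F ^+ k *m X) i j * t ^+ k) @ \oo -->
  (Out *m expmx (t *: F) *m X) i j.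
Proof.
pose s := series (fun k : nat => (k`!%:R)^-1 *: (t *: F) ^+ k).
have cs : s @ \oo --> expmx (t *: F) by exact: (is_cvg_expmx (M := t *: F)).
have -> : series (fun k => (k`!%:R)^-1 * (Out *m F ^+ k *m X) i j * t ^+ k) =
    (fun n => (Out *m s n *m X) i j).
  apply/funext => n; rewrite /s /series /= mulmx_sumr mulmx_suml summxE.
  apply: eq_bigr => k _.
  by rewrite exprmxZ scalerA -scalemxAr -scalemxAl [RHS]mxE mulrAC.
under eq_fun do rewrite mxE; rewrite mxE.
apply: cvg_big => [|l _]; first exact: add_continuous.
apply: cvgM; last exact: cvg_cst.
under eq_fun do rewrite mxE; rewrite mxE.
apply: cvg_big => [|h _]; first exact: add_continuous.
apply: cvgM; first exact: cvg_cst.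
exact: (@continuous_cvg _ 'M[R]_m R \oo _ s (fun M => M h l) _
  (@coord_continuous R m m h l _) cs).
Qed.

(** Reduces indiscernibility, an analytic condition on outputs over time, to an
    algebraic one on Markov parameters. *)
Lemma indiscernibleP (R : realType) m q (Out : 'M[R]_(q, m)) (F G : 'M[R]_m)
    (X Y : 'cV[R]_m) :
  indiscernible Out F G X Y <->
  forall k, Out *m F ^+ k *m X = Out *m G ^+ k *m Y.
Proof.
split=> [FG k|FG t _]; apply/matrixP => i j; last first.
  have cF := @cvg_expmx_entry _ _ _ _ Out F X t i j.
  have cG := @cvg_expmx_entry _ _ _ _ Out G Y t i j.
  rewrite -(cvg_lim _ cF)// -(cvg_lim _ cG)//.
  by under eq_fun do rewrite FG.
pose a M (Z : 'cV[R]_m) k : R := (k`!%:R)^-1 * (Out *m M ^+ k *m Z) i j.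
suff /(_ k)/eqP : forall k, a F X k - a G Y k = 0.
  by rewrite subr_eq0 => /eqP /mulfI -> //;
    rewrite invr_eq0 pnatr_eq0 -lt0n fact_gt0.
apply: pseries_eq0 => t /andP[t0 _].
have cF := @cvg_expmx_entry _ _ _ _ Out F X t i j.
have cG := @cvg_expmx_entry _ _ _ _ Out G Y t i j.
have -> : series (fun k => (a F X k - a G Y k) * t ^+ k) =
    series (fun k => a F X k * t ^+ k) - series (fun k => a G Y k * t ^+ k).
  apply/funext => n; rewrite /series /= fctE -sumrB.
  by apply: eq_bigr => l _; rewrite mulrBl.
rewrite -(subrr ((Out *m expmx (t *: F) *m X) i j)).
by apply: cvgB; [exact: cF|rewrite FG ?(ltW t0)//; exact: cG].
Qed.

Lemma netmx_tens (R : realType) N n (A H : 'M[R]_n) (L : 'M[R]_N)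
    (x : 'cV[R]_N) (v : 'cV[R]_n) :
  netmx A H L *m (x *t v) = x *t (A *m v) + (L *m x) *t (H *m v).
Proof. by rewrite mulmxDl !tensmx_mul mul1mx. Qed.

(** One step of the network splits [x *t v] into two pure tensors, with node
    states [x] and [L *m x]; both satisfy the hypothesis together with their
    counterparts [y] and [Lbar *m y], so the induction is over [x], [y] and
    [v]. *)
Lemma netmx_markov (R : realType) N q n p (A H : 'M[R]_n) (C : 'M[R]_(p, n))
    (Out : 'M[R]_(q, N)) (L Lbar : 'M[R]_N) k (x y : 'cV[R]_N) (v : 'cV[R]_n) :
  (forall j, Out *m L ^+ j *m x = Out *m Lbar ^+ j *m y) ->
  (Out *t C) *m netmx A H L ^+ k *m (x *t v) =
  (Out *t C) *m netmx A H Lbar ^+ k *m (y *t v).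
Proof.
elim: k x y v => [|k IH] x y v xy.
  by have := xy 0%N; rewrite !expr0 !mulmx1 !tensmx_mul => ->.
rewrite !exprSr !mulmxA -!mulmxA !netmx_tens !mulmxDr !mulmxA (IH x y)//.
congr (_ + _); apply: IH => j.
by have := xy j.+1; rewrite !exprSr !mulmxA.
Qed.

Lemma tensmx_const1_eq0 (R : realType) N n (x : 'cV[R]_N) :
  (0 < n)%N -> x *t (const_mx 1 : 'cV[R]_n) = 0 -> x = 0.
Proof.
move=> n0 /matrixP x0; apply/matrixP => i j.
have := x0 (mxtens_index (i, Ordinal n0)) (mxtens_index (j, ord0)).
by rewrite tensmxE !mxE mulr1.
Qed.

Theorem corollary3 (R : realType) (N n p : nat)
    (A H : 'M[R]_n) (C : 'M[R]_(p, n)) (L Lbar : 'M[R]_N) (S : {set 'I_N})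
    (hN : (2 <= N)%N) (hn : (0 < n)%N) (hL : hollow L) (hLbar : hollow Lbar) :
  discernible (netout S C) (netmx A H L) (netmx A H Lbar) ->
  discernible (measmx R S) L Lbar.
Proof.
move=> disc x y /indiscernibleP xy.
pose v : 'cV[R]_n := const_mx 1.
have [|x0 y0] := disc (x *t v) (y *t v).
  by apply/indiscernibleP => k; exact: netmx_markov.
by split; apply: (tensmx_const1_eq0 hn).
Qed.
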